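(* Let $\mathbf{X}=\{X^n\}_{n=1}^\infty$ be a general source with finite alphabet $\mathcal{X}$, let $\hat{\mathcal{X}}$ be a finite output alphabet, let $\{c_n\}_{n=1}^\infty$, $c_n:\mathcal{X}^n\times\hat{\mathcal{X}}^n\to[0,\infty)$, be uniformly bounded cost functions, and let $\epsilon\ge0$. When $\mathbf{Y}=\mathbf{X}$ and $R\ge\log|\hat{\mathcal{X}}|$, the minimum average cost under the weak independence criterion satisfies $$C_{\rm a}(\epsilon,R)=\inf_{\hat{\mathbf{X}}:\ I(\mathbf{X};\hat{\mathbf{X}})\le\epsilon}c(\mathbf{X},\hat{\mathbf{X}}),$$ where the infimum is over all sequences $\hat{\mathbf{X}}=\{\hat X^n\}_{n=1}^\infty$ of random variables, $\hat X^n$ taking values in $\hat{\mathcal{X}}^n$ and jointly distributed with $X^n$, satisfying $I(\mathbf{X};\hat{\mathbf{X}})\le\epsilon$.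
   Context: $\mathcal{X},\hat{\mathcal{X}}$ are finite nonempty sets; $\log$ is the natural logarithm; $I(\cdot;\cdot)$ is mutual information. A general source $\mathbf{X}=\{X^n\}_{n=1}^\infty$ is an arbitrary sequence of random variables, $X^n$ taking values in $\mathcal{X}^n$ (no consistency between different $n$ is required). The condition $\mathbf{Y}=\mathbf{X}$ means $Y^n=X^n$ for all $n$. The cost functions $c_n:\mathcal{X}^n\times\hat{\mathcal{X}}^n\to[0,\infty)$ satisfy $\sup_{n\ge1}\sup_{(x^n,\hat x^n)}c_n(x^n,\hat x^n)<\infty$. For a positive integer $M_n$, $U_{M_n}$ is uniformly distributed on $\mathcal{U}_{M_n}=\{1,\dots,M_n\}$ and independent of $(X^n,Y^n)$. An encoder is a (deterministic) map $f_n:\mathcal{X}^n\times\mathcal{U}_{M_n}\to\hat{\mathcal{X}}^n$. For $R,\Gamma,\epsilon\ge0$, $(R,\Gamma)$ is $\epsilon$-weakly achievable in the sense of the average cost if there exist a sequence of positive integers $\{M_n\}$ and encoders $\{f_n\}$ such that $\limsup_{n\to\infty}\frac1n\log M_n\le R$, $\limsup_{n\to\infty}\frac1n I(Y^n;f_n(X^n,U_{M_n}))\le\epsilon$, and $\limsup_{n\to\infty}\mathrm{E}[c_n(X^n,f_n(X^n,U_{M_n}))]\le\Gamma$. Define $C_{\rm a}(\epsilon,R)=\inf\{\Gamma\ge 0:(R,\Gamma)\text{ is }\epsilon\text{-weakly achievable in the sense of the average cost}\}$. Define $I(\mathbf{X};\hat{\mathbf{X}})=\limsup_{n\to\infty}\frac1nI(X^n;\hat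 X^n)$ and $c(\mathbf{X},\hat{\mathbf{X}})=\limsup_{n\to\infty}\mathrm{E}[c_n(X^n,\hat X^n)]$. *)

(* Defs.v *)
From mathcomp Require Import all_boot all_order all_algebra.
From mathcomp Require Import all_classical all_reals all_analysis.

Set Implicit Arguments.
Unset Strict Implicit.
Unset Printing Implicit Defensive.

Import Order.TTheory GRing.Theory Num.Theory.
Local Open Scope classical_set_scope.
Local Open Scope ring_scope.

(* All random variables take values in finite sets, so they
   are modelled as functions on a finite sample space Omega equipped with a
   probability mass function. *)

Definition is_pmf (R : realType) (Omega : finType) (p : Omega -> R) : Prop :=
  (forall w, 0 <= p w) /\ \sum_(w : Omega) p w = 1.

Definition rv_law (R : realType) (Omega A : finType) (p : Omega -> R)
    (Z : Omega -> A) (a : A) : R :=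
  \sum_(w : Omega | Z w == a) p w.

Definition expect (R : realType) (Omega : finType) (p : Omega -> R)
    (Z : Omega -> R) : R :=
  \sum_(w : Omega) p w * Z w.

(* I(Y; Z) in nats. The terms with P(Y = a, Z = b) = 0 vanish, which is the
   convention 0 log 0 = 0. *)
Definition mutual_info (R : realType) (Omega A B : finType) (p : Omega -> R)
    (Y : Omega -> A) (Z : Omega -> B) : R :=
  \sum_(a : A) \sum_(b : B)
    let pab := rv_law p (fun w => (Y w, Z w)) (a, b) in
    pab * ln (pab / (rv_law p Y a * rv_law p Z b)).

(* The sample space Omega enlarged by a variable U (the second coordinate)
   that is uniform on 'I_m and independent of everything defined on Omega. *)
Definition with_uniform (R : realType) (Omega : finType) (p : Omega -> R)
    (m : nat) (w : Omega * 'I_m) : R :=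
  p w.1 * m%:R^-1.

(* Sequences start at n = 1: the entry n = 0 is unconstrained and does not
   affect any limit superior. *)

(* (r, g) is eps-weakly achievable for the average cost, for the pair of
   general sources X^n, Y^n defined on the sample space (Omega n, p n). *)
Definition weakly_achievable (R : realType) (X Y Xh : finType)
    (Omega : nat -> finType) (p : forall n, Omega n -> R)
    (Xn : forall n, Omega n -> n.-tuple X)
    (Yn : forall n, Omega n -> n.-tuple Y)
    (c : forall n, n.-tuple X -> n.-tuple Xh -> R) (eps r g : R) : Prop :=
  exists (M : nat -> nat)
         (f : forall n, n.-tuple X -> 'I_(M n) -> n.-tuple Xh),
    [/\ forall n, (0 < n)%N -> (0 < M n)%N,
        (limn_esup (fun n => (n%:R^-1 * ln (M n)%:R)%:E) <= r%:E)%E,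
        (limn_esup (fun n =>
           (n%:R^-1 * mutual_info (with_uniform (p n) (m := M n))
                        (fun w => Yn n w.1)
                        (fun w => f n (Xn n w.1) w.2))%:E) <= eps%:E)%E &
        (limn_esup (fun n =>
           (expect (with_uniform (p n) (m := M n))
              (fun w => c n (Xn n w.1) (f n (Xn n w.1) w.2)))%:E)
         <= g%:E)%E].

(* C_a(eps, r), with value +oo if no cost is achievable. *)
Definition min_avg_cost (R : realType) (X Y Xh : finType)
    (Omega : nat -> finType) (p : forall n, Omega n -> R)
    (Xn : forall n, Omega n -> n.-tuple X)
    (Yn : forall n, Omega n -> n.-tuple Y)
    (c : forall n, n.-tuple X -> n.-tuple Xh -> R) (eps r : R) : \bar R :=
  ereal_inf [set g%:E | g in
    [set g : R | 0 <= g /\ weakly_achievable p Xn Yn c eps r g]].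

(* W n is the joint law of (X^n, Xh^n) for some Xh^n jointly distributed with
   the given X^n. *)
Definition joint_with (R : realType) (X Xh : finType)
    (Omega : nat -> finType) (p : forall n, Omega n -> R)
    (Xn : forall n, Omega n -> n.-tuple X)
    (W : forall n, n.-tuple X * n.-tuple Xh -> R) : Prop :=
  forall n, (0 < n)%N ->
    is_pmf (W n) /\ forall x, rv_law (W n) fst x = rv_law (p n) (Xn n) x.

Definition sup_info_rate (R : realType) (X Xh : finType)
    (W : forall n, n.-tuple X * n.-tuple Xh -> R) : \bar R :=
  limn_esup (fun n => (n%:R^-1 * mutual_info (W n) fst snd)%:E).

Definition sup_avg_cost (R : realType) (X Xh : finType)
    (c : forall n, n.-tuple X -> n.-tuple Xh -> R)
    (W : forall n, n.-tuple X * n.-tuple Xh -> R) : \bar R :=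
  limn_esup (fun n => (expect (W n) (fun w => c n w.1 w.2))%:E).

(* Main.v *)
(* An encoder f(X, U) induces a joint law of (X, f(X, U)), so the right-hand side
   is at most C_a. Conversely, a joint law W of (X^n, Xh^n) is a kernel V(y | x),
   and with M = n |Xh|^n values of U each V(. | x) can be quantized to multiples
   of 1/M with pointwise error at most 1/M. Writing the mutual information as
   sum_x P(x) sum_y phi(V(y | x)) - sum_y phi(Q(y)) with phi t = t ln t, whose
   modulus of continuity is at most d (1 - ln d), the quantization increases it
   by at most 2 |Xh|^n (1 + ln M) / M = O(1), and the expected cost by O(1/n);
   both vanish in the limit after normalization, while (ln M) / n tends to
   ln |Xh|. *)
Require Import Defs.
From mathcomp Require Import all_boot all_order all_algebra.
From mathcomp Require Import all_classical all_reals all_analysis.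
From mathcomp Require Import ring lra.
Import Order.TTheory GRing.Theory Num.Theory.
Local Open Scope classical_set_scope.
Local Open Scope ring_scope.

(** * Limits superior in epsilon form, and growth of [ln n] *)

Lemma limn_esup_le_EFinP (R : realType) (u : nat -> R) (l : R) :
  (limn_esup (fun n => (u n)%:E) <= l%:E)%E <->
  (forall e, 0 < e -> \forall n \near \oo, u n <= l + e).
Proof.
split=> [ul e e0 | ul].
  have : (limn_esup (fun n => (u n)%:E) < (l + e)%:E)%E.
    by apply: le_lt_trans ul _; rewrite lte_fin ltrDl.
  case/ereal_inf_lt => _ [V /= VF <-] sV.
  near=> n; rewrite -lee_fin; apply: le_trans (ltW sV).
  by apply: ereal_sup_ubound; exists n => //; near: n.
apply/lee_addgt0Pr => e e0; rewrite -EFinD.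
have [V VF uV] : exists2 V, \oo V & forall n, V n -> u n <= l + e.
  by exists [set n | u n <= l + e] => //; exact: ul.
apply: (@le_trans _ _ (ereal_sup [set (u n)%:E | n in V])).
  by apply: ereal_inf_lbound; exists V.
by apply: ge_ereal_sup => _ [n Vn <-]; rewrite lee_fin uV.
Unshelve. all: by end_near. Qed.

Lemma near_mul_le_natr (R : realType) (K e : R) : 0 < e ->
  \forall n \near \oo, K <= e * n%:R.
Proof.
move=> e0; near=> n; rewrite -ler_pdivrMl// mulrC.
apply: le_trans (ltW (truncnS_gt _)) _; rewrite ler_nat.
by near: n; exact: nbhs_infty_ge.
Unshelve. all: by end_near. Qed.

Lemma near_ln_natr_le (R : realType) (e : R) : 0 < e ->
  \forall n \near \oo, ln (n%:R : R) <= e * n%:R.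
Proof.
move=> e0; have e20 : 0 < e / 2 by rewrite divr_gt0.
near=> n.
have n0 : 0 < n%:R :> R by rewrite ltr0n; near: n; exact: nbhs_infty_gt.
(* Scaling by [e / 2] before applying ln x < x costs only the constant ln (2 / e), which the other
   half of [e * n] absorbs for large [n]. *)
have -> : ln (n%:R : R) = ln (e / 2 * n%:R) + ln (e / 2)^-1.
  rewrite -lnM ?posrE ?invr_gt0 ?mulr_gt0//.
  by rewrite mulrAC mulfV ?mul1r// gt_eqF.
rewrite [e in _ <= e * _]splitr mulrDl.
rewrite lerD//; first by rewrite ltW// ln_sublinear// mulr_gt0.
by near: n; exact: near_mul_le_natr.
Unshelve. all: by end_near. Qed.

(** * Modulus of continuity of t ln t on [0, 1] *)

(** This is ln u <= u - 1 at u = z / x, multiplied by [x]. *)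
Lemma mulr_ln_le (R : realType) (x z : R) : 0 < x -> 0 < z ->
  x * ln z <= x * ln x + (z - x).
Proof.
move=> x0 z0; rewrite -lerBlDl -mulrBr -ln_div ?posrE//.
have -> : z - x = x * (z / x - 1) by rewrite mulrBr mulrCA mulfV ?gt_eqF// !mulr1.
rewrite ler_pM2l// -{1}(subrKC 1 (z / x)) le_ln1Dx//.
by rewrite ltrBrDr addNr divr_gt0.
Qed.

(** If b = a + s with s > 0, monotonicity of ln gives b ln b >= a ln a + s ln s, and [mulr_ln_le]
    gives s ln s >= d ln d - d. If a > b, [mulr_ln_le] bounds b ln a by b ln b + (a - b), while (a -
    b) ln a <= 0; the error is then at most [d]. *)
Lemma xlnx_le_dist (R : realType) (a b d : R) :
  0 <= a <= 1 -> 0 <= b <= 1 -> `|a - b| <= d -> d <= 1 ->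
  a * ln a <= b * ln b + d * (1 - ln d).
Proof.
move=> /andP[a0 a1] /andP[b0 b1] abd d1.
have d0 : 0 <= d by exact: le_trans abd.
have lnd : d * ln d <= 0 by rewrite mulr_ge0_le0 ?ln_le0.
have dlnd : d <= d * (1 - ln d) by lra.
move: abd; rewrite ler_norml => /andP[abl abd]; have [ab|ba] := leP (a - b) 0.
  have := ab; rewrite le_eqVlt subr_eq0 => /predU1P[->|ab'].
    by lra.
  have [s [bE s1 sd]] : exists s, [/\ b = a + s, 0 < s & s <= d].
    by exists (b - a); split; lra.
  rewrite bE.
  have sln : s * ln d <= s * ln s + (d - s) by rewrite mulr_ln_le// (lt_le_trans s1).
  have dsln : d * ln d <= s * ln d by rewrite ler_wnM2r// ln_le0.
  have mon x : 0 < x -> x <= a + s -> x * ln x <= x * ln (a + s).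
    by move=> x0 xs; rewrite ler_pM2l// ler_ln// posrE; exact: lt_le_trans xs.
  have := mon s s1; rewrite lerDr => /(_ a0).
  have : a * ln a <= a * ln (a + s).
    move: a0; rewrite le_eqVlt => /predU1P[<-|a0]; first by rewrite !mul0r.
    by apply: mon => //; rewrite lerDl ltW.
  by rewrite mulrDl => *; lra.
have lna : (a - b) * ln a <= 0 by rewrite pmulr_rle0// ln_le0.
(* [mulr_ln_le] requires b > 0; for b = 0 the claim follows from a ln a <= 0. *)
move: b0; rewrite le_eqVlt => /predU1P[b0|b0].
  move: lna; rewrite -b0 subr0 mul0r add0r => *; lra.
have := mulr_ln_le _ _ _ b0 (lt_le_trans b0 (_ : b <= a)).
by move=> /(_ ltac:(lra)); move: lna; rewrite mulrBl => *; lra.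
Qed.

(** * Quantization of a probability mass function *)

(** List each [y] exactly [k y] times: the list has length [m], and [h] reads off its entries. *)
Lemma counts_map (T : finType) (k : T -> nat) (m : nat) :
  (\sum_(y : T) k y)%N = m ->
  exists h : 'I_m -> T, forall y, #|[pred u | h u == y]| = k y.
Proof.
move=> sk; pose s := flatten [seq nseq (k y) y | y <- enum T].
have ss : size s == m.
  rewrite size_flatten /shape -map_comp sumnE big_map big_enum /= -sk.
  by apply/eqP; apply: eq_bigr => y _; rewrite size_nseq.
exists (tnth (Tuple ss)) => y.
rewrite -sum1_card -(big_tuple _ _ (Tuple ss) (fun z => z == y) (fun=> 1%N)).
rewrite sum1_count /= count_flatten -map_comp sumnE big_map big_enum /=.
rewrite (bigD1 y)//= count_nseq eqxx mul1n big1 ?addn0// => z /negbTE zy.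
by rewrite count_nseq /= zy.
Qed.

(** Rounding each [v y] separately would not give counts with sum [m]. Instead the cumulative sums
    [F] are rounded: [t j] is the integer part of m F(j), the increments of [t] telescope to [m],
    and each differs from m v(y) by less than 1. *)
Lemma quantize_pmf (R : realType) (T : finType) (v : T -> R) (m : nat) :
  is_pmf v -> (0 < m)%N ->
  exists h : 'I_m -> T,
    forall y, `|#|[pred u | h u == y]|%:R / m%:R - v y| <= m%:R^-1.
Proof.
move=> [v0 v1] m0.
pose F j := \sum_(i < #|T| | (i < j)%N) v (enum_val i).
pose t j := Num.truncn (m%:R * F j).
have F0 j : 0 <= F j by apply: sumr_ge0.
have FS (i : 'I_#|T|) : F i.+1 = F i + v (enum_val i).
  rewrite /F (bigD1 i) ?ltnS//= addrC; congr (_ + _).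
  by apply: eq_bigl => j; rewrite ltnS ltn_neqAle andbC.
have FT : F #|T| = 1.
  rewrite -v1 /F (reindex_onto enum_rank enum_val) /=; last by move=> i _; rewrite enum_valK.
  by apply: eq_big => [y|y _]; rewrite ?ltn_ord enum_rankK ?eqxx.
(* Subtraction in [nat] truncates; monotonicity makes the increments of [t] genuine differences. *)
have tle : {homo t : i j / (i <= j)%N}.
  move=> i j ij; apply: le_truncn; rewrite ler_wpM2l//.
  rewrite [leRHS]/F [leLHS]/F [leLHS]big_mkcond [leRHS]big_mkcond; apply: ler_sum => a _.
  by case: ifP => [ai|_]; [rewrite (leq_trans ai ij)|case: ifP].
have st : (\sum_(y : T) (t (enum_rank y).+1 - t (enum_rank y)))%N = m.
  rewrite (reindex_onto enum_val enum_rank) /=; last by move=> i _; rewrite enum_rankK.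
  rewrite (eq_bigl xpredT); last by move=> i; rewrite enum_valK eqxx.
  under eq_bigr do rewrite enum_valK.
  rewrite -(big_mkord xpredT (fun i => t i.+1 - t i)%N) telescope_sumn//.
  rewrite /t FT mulr1 natrK {1}/F big_pred0 ?mulr0 ?truncn0 ?subn0//.
have [h hk] := counts_map _ _ _ st; exists h => y.
rewrite hk natrB ?tle// ler_norml.
have m0' : 0 < m%:R :> R by rewrite ltr0n.
have itv j : (t j)%:R <= m%:R * F j < (t j).+1%:R by apply: truncn_itv; rewrite mulr_ge0.
have := FS (enum_rank y); rewrite enum_rankK.
move: (itv (enum_rank y)) (itv (enum_rank y).+1); rewrite -!natr1.
set A : R := (t (enum_rank y))%:R; set B : R := (t (enum_rank y).+1)%:R => /andP[a1 a2] /andP[b1 b2] Fe.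
move: b1 b2; rewrite Fe mulrDr => b1 b2.
rewrite -(ler_pM2l m0') -[X in _ && X](ler_pM2l m0') mulrN mulfV ?gt_eqF// mulrBr mulrCA mulfV ?gt_eqF// mulr1.
by apply/andP; split; lra.
Qed.

(** * Laws of random variables and the independent uniform variable *)

Lemma rv_law_ge0 (R : realType) (Omega A : finType) (p : Omega -> R)
    (Z : Omega -> A) (a : A) : is_pmf p -> 0 <= rv_law p Z a.
Proof. by move=> [p0 _]; apply: sumr_ge0. Qed.

Lemma rv_law_rv_law (R : realType) (Omega A B : finType) (p : Omega -> R)
    (Z : Omega -> A) (g : A -> B) (b : B) :
  rv_law (rv_law p Z) g b = rv_law p (fun w => g (Z w)) b.
Proof.
rewrite [RHS](partition_big Z (fun a => g a == b))//=.
apply: eq_bigr => a gab; apply: eq_bigl => w.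
by case: eqP => [->|]; rewrite ?gab// andbF.
Qed.

Lemma expect_rv_law (R : realType) (Omega A : finType) (p : Omega -> R)
    (Z : Omega -> A) (g : A -> R) :
  expect (rv_law p Z) g = expect p (fun w => g (Z w)).
Proof.
rewrite /expect [RHS](partition_big Z xpredT)//=; apply: eq_bigr => a _.
by rewrite mulr_suml; apply: eq_bigr => w /eqP ->.
Qed.

Lemma sum_rv_law (R : realType) (Omega A : finType) (p : Omega -> R)
    (Z : Omega -> A) : \sum_(a : A) rv_law p Z a = \sum_(w : Omega) p w.
Proof. by rewrite [RHS](partition_big Z xpredT). Qed.

Lemma is_pmf_rv_law (R : realType) (Omega A : finType) (p : Omega -> R)
    (Z : Omega -> A) : is_pmf p -> is_pmf (rv_law p Z).
Proof.
by move=> pp; split=> [a|]; [exact: rv_law_ge0 | rewrite sum_rv_law pp.2].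
Qed.

Lemma is_pmf_with_uniform (R : realType) (Omega : finType) (p : Omega -> R)
    (m : nat) : is_pmf p -> (0 < m)%N -> is_pmf (with_uniform p (m := m)).
Proof.
move=> [p0 p1] m0; split=> [w|]; first by rewrite mulr_ge0// invr_ge0.
rewrite -(pair_bigA _ (fun w u => p w * m%:R^-1)) -[RHS]p1 /=.
apply: eq_bigr => w _; rewrite sumr_const card_ord -[LHS]mulr_natr mulfVK//.
by rewrite pnatr_eq0 -lt0n.
Qed.

(** Given Z = a, the output is [f a] applied to a uniform variable, so a randomized encoder is a
    kernel whose entries are multiples of 1/m. *)
Lemma rv_law_with_uniform (R : realType) (Omega A B : finType) (p : Omega -> R)
    (m : nat) (Z : Omega -> A) (f : A -> 'I_m -> B) (a : A) (b : B) :
  rv_law (with_uniform p (m := m)) (fun w => (Z w.1, f (Z w.1) w.2)) (a, b) =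
  rv_law p Z a * (#|[pred u | f a u == b]|%:R / m%:R).
Proof.
rewrite /rv_law /with_uniform mulr_suml.
transitivity (\sum_(w | Z w == a) \sum_(u | f a u == b) p w / m%:R).
  rewrite pair_big_dep/=; apply: eq_bigl => -[w u]; rewrite xpair_eqE/=.
  by case: eqP => // ->.
apply: eq_bigr => w _; rewrite sumr_const -mulr_natl; lra.
Qed.

Lemma rv_law_pair_fst (R : realType) (Omega A B : finType) (p : Omega -> R)
    (Y : Omega -> A) (Z : Omega -> B) (a : A) :
  \sum_b rv_law p (fun w => (Y w, Z w)) (a, b) = rv_law p Y a.
Proof.
by rewrite [RHS](partition_big Z xpredT).
Qed.

Lemma rv_law_pair_snd (R : realType) (Omega A B : finType) (p : Omega -> R)
    (Y : Omega -> A) (Z : Omega -> B) (b : B) :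
  \sum_a rv_law p (fun w => (Y w, Z w)) (a, b) = rv_law p Z b.
Proof.
rewrite [RHS](partition_big Y xpredT)//=; apply: eq_bigr => a _.
by apply: eq_bigl => w; rewrite xpair_eqE andbC.
Qed.

(** * Mutual information through kernels, and its continuity *)

Lemma mutual_info_rv_law (R : realType) (Omega A B : finType) (p : Omega -> R)
    (Y : Omega -> A) (Z : Omega -> B) :
  mutual_info (rv_law p (fun w => (Y w, Z w))) fst snd = mutual_info p Y Z.
Proof.
apply: eq_bigr => a _; apply: eq_bigr => b _.
by rewrite !rv_law_rv_law.
Qed.

(* [I(Y; Z) = H(Z) - H(Z | Y)] for the law [P] of [Y] and the kernel [V]. *)
Lemma mutual_info_kernel (R : realType) (Omega A B : finType) (p : Omega -> R)
    (Y : Omega -> A) (Z : Omega -> B) (P : A -> R) (V : A -> B -> R) :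
  (forall a, 0 <= P a) -> (forall a, is_pmf (V a)) ->
  (forall a b, rv_law p (fun w => (Y w, Z w)) (a, b) = P a * V a b) ->
  mutual_info p Y Z =
    \sum_a P a * (\sum_b V a b * ln (V a b)) -
    \sum_b (\sum_a P a * V a b) * ln (\sum_a P a * V a b).
Proof.
move=> P0 Vp pE.
have YE a : rv_law p Y a = P a.
  rewrite -(rv_law_pair_fst _ _ _ _ _ _ Z); rewrite (eq_bigr _ (fun b _ => pE a b)).
  by rewrite -mulr_sumr (Vp a).2 mulr1.
have ZE b : rv_law p Z b = \sum_a P a * V a b.
  by rewrite -(rv_law_pair_snd _ _ _ _ _ Y); apply: eq_bigr => a _; exact: pE.
under [in RHS]eq_bigr do rewrite mulr_sumr.
under [X in _ - X]eq_bigr do rewrite mulr_suml.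
rewrite [X in _ - X]exchange_big/= -sumrB; apply: eq_bigr => a _.
rewrite -sumrB; apply: eq_bigr => b _.
rewrite pE YE ZE /=; set Q := \sum_i _.
(* Terms of zero joint mass vanish on both sides. Elsewhere [PVQ] makes the mixture [Q] positive as
   well, so [P a] cancels and the logarithm of the quotient splits. *)
have [/eqP PV0|PV0] := boolP (P a * V a b == 0); first by rewrite mulrA PV0 !mul0r subr0.
have PVQ : P a * V a b <= Q.
  rewrite /Q (bigD1 a)//= lerDl; apply: sumr_ge0 => i _.
  by rewrite mulr_ge0// (Vp i).1.
move: PV0; rewrite mulf_eq0 negb_or => /andP[Pa Vab].
have Pa0 : 0 < P a by rewrite lt_def Pa P0.
have Vab0 : 0 < V a b by rewrite lt_def Vab (Vp a).1.
have Q0 : 0 < Q by rewrite (lt_le_trans _ PVQ) ?mulr_gt0.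
rewrite -mulf_div mulfV// mul1r ln_div ?posrE//; ring.
Qed.

Lemma pmf_le1 (R : realType) (A : finType) (v : A -> R) (a : A) :
  is_pmf v -> 0 <= v a <= 1.
Proof.
move=> [v0 v1]; rewrite v0 -v1 (bigD1 a)//= lerDl; exact: sumr_ge0.
Qed.

Lemma is_pmf_mixture (R : realType) (A B : finType) (P : A -> R)
    (V : A -> B -> R) :
  is_pmf P -> (forall a, is_pmf (V a)) -> is_pmf (fun b => \sum_a P a * V a b).
Proof.
move=> [P0 P1] Vp; split=> [b|].
  by apply: sumr_ge0 => a _; rewrite mulr_ge0// (Vp a).1.
rewrite exchange_big -P1; apply: eq_bigr => a _.
by rewrite -mulr_sumr (Vp a).2 mulr1.
Qed.

Lemma mixture_dist (R : realType) (A B : finType) (P : A -> R)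
    (V V' : A -> B -> R) (d : R) (b : B) :
  is_pmf P -> (forall a, `|V' a b - V a b| <= d) ->
  `|\sum_a P a * V' a b - \sum_a P a * V a b| <= d.
Proof.
move=> [P0 P1] Vd; rewrite -sumrB (le_trans (ler_norm_sum _ _ _))//.
rewrite -[leRHS]mul1r -P1 mulr_suml; apply: ler_sum => a _.
by rewrite -mulrBr normrM ger0_norm// ler_wpM2l.
Qed.

(** The factor 2 counts the two entropies of [mutual_info_kernel]: the kernels differ by at most [d]
    entrywise, hence so do their mixtures under [P], and [xlnx_le_dist] applies to both. The sample
    spaces differ because one pair will be a joint law on a product and the other an encoder
    output. *)
Lemma mutual_info_kernel_le_dist (R : realType) (Omega Omega' A B : finType)
    (p : Omega -> R) (Y : Omega -> A) (Z : Omega -> B)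
    (p' : Omega' -> R) (Y' : Omega' -> A) (Z' : Omega' -> B)
    (P : A -> R) (V V' : A -> B -> R) (d : R) :
  is_pmf P -> (forall a, is_pmf (V a)) -> (forall a, is_pmf (V' a)) ->
  (forall a b, rv_law p (fun w => (Y w, Z w)) (a, b) = P a * V a b) ->
  (forall a b, rv_law p' (fun w => (Y' w, Z' w)) (a, b) = P a * V' a b) ->
  (forall a b, `|V' a b - V a b| <= d) -> d <= 1 ->
  mutual_info p' Y' Z' <=
    mutual_info p Y Z + #|B|%:R * (d * (1 - ln d)) *+ 2.
Proof.
move=> Pp Vp Vp' pE pE' Vd d1; have [P0 P1] := Pp.
rewrite (mutual_info_kernel _ _ _ _ _ _ _ _ _ P0 Vp pE).
rewrite (mutual_info_kernel _ _ _ _ _ _ _ _ _ P0 Vp' pE').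
set D := d * (1 - ln d).
have sumB (f g : B -> R) : (forall b, f b <= g b + D) ->
    \sum_b f b <= \sum_b g b + #|B|%:R * D.
  move=> fg; rewrite mulr_natl -sumr_const -big_split/=; exact: ler_sum.
have H1 : \sum_a P a * (\sum_b V' a b * ln (V' a b)) <=
    \sum_a P a * (\sum_b V a b * ln (V a b)) + #|B|%:R * D.
  rewrite -[X in _ + X]mul1r -[X in _ + X * _]P1 mulr_suml -big_split/=; apply: ler_sum => a _.
  rewrite -mulrDr ler_wpM2l//; apply: sumB => b.
  by rewrite xlnx_le_dist ?pmf_le1.
have H2 : \sum_b (\sum_a P a * V a b) * ln (\sum_a P a * V a b) <=
    \sum_b (\sum_a P a * V' a b) * ln (\sum_a P a * V' a b) + #|B|%:R * D.
  apply: sumB => b; apply: xlnx_le_dist => //.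
  - exact: (pmf_le1 _ _ _ b (is_pmf_mixture _ _ _ _ _ Pp Vp)).
  - exact: (pmf_le1 _ _ _ b (is_pmf_mixture _ _ _ _ _ Pp Vp')).
  - by rewrite distrC mixture_dist.
rewrite mulr2n; lra.
Qed.

Lemma joint_law_kernel (R : realType) (A B : finType) (W : A * B -> R) :
  is_pmf W -> exists V : A -> B -> R, (forall a, is_pmf (V a)) /\
    forall a b, W (a, b) = rv_law W fst a * V a b.
Proof.
move=> [W0 W1].
have WE a : rv_law W fst a = \sum_b W (a, b).
  rewrite -(rv_law_pair_fst _ _ _ _ _ _ snd); apply: eq_bigr => b _.
  by rewrite /rv_law (big_pred1 (a, b))// => -[].
(* [B] is nonempty because an empty sum is not 1. The point mass at [b0] fills the rows where
   conditioning is undefined, so that every row is a pmf. *)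
have [b0 _] : exists b : B, true.
  case: (pickP (fun _ : A * B => true)) => [[_ b] _|AB0]; first by exists b.
  by move: W1; rewrite big_pred0// => /eqP; rewrite eq_sym oner_eq0.
exists (fun a b => if rv_law W fst a == 0 then (b == b0)%:R
                   else W (a, b) / rv_law W fst a); split=> [a|a b].
  have [Wa|Wa] := boolP (rv_law W fst a == 0).
    by split=> //; rewrite (bigD1 b0)//= eqxx big1 ?addr0// => b /negbTE ->.
  split=> [b|]; first by rewrite divr_ge0// sumr_ge0.
  by rewrite -mulr_suml -WE mulfV.
case: ifPn => Wa; last by rewrite mulrCA mulfV ?mulr1.
(* A row of zero marginal mass has only zero entries, each lying between 0 and the row sum. *)
rewrite (eqP Wa) mul0r; apply/eqP; rewrite eq_le W0 andbT -(eqP Wa) WE.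
by rewrite (bigD1 b)//= lerDl sumr_ge0.
Qed.

(** * Simulating a joint law by an encoder with uniform randomness *)

(** Quantizing every row of the kernel of [W] gives distance d = 1/m, whence 1 - ln d = 1 + ln m.
    The same [f] serves the information bound and every cost bounded by [K]. *)
Lemma encoder_approximation (R : realType) (Omega A B : finType)
    (p : Omega -> R) (Z : Omega -> A) (W : A * B -> R) (m : nat) :
  is_pmf p -> is_pmf W -> (forall a, rv_law W fst a = rv_law p Z a) ->
  (0 < m)%N ->
  exists f : A -> 'I_m -> B,
    mutual_info (with_uniform p (m := m)) (fun w => Z w.1)
        (fun w => f (Z w.1) w.2) <=
      mutual_info W fst snd + #|B|%:R * (m%:R^-1 * (1 + ln m%:R)) *+ 2 /\
    forall (c : A -> B -> R) (K : R), (forall a b, 0 <= c a b <= K) ->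
      expect (with_uniform p (m := m)) (fun w => c (Z w.1) (f (Z w.1) w.2)) <=
        expect W (fun w => c w.1 w.2) + K * (#|B|%:R / m%:R).
Proof.
move=> pp Wp WZ m0; have [V [Vp WV]] := joint_law_kernel _ _ _ _ Wp.
have m0' : 0 < m%:R :> R by rewrite ltr0n.
have [f fV] := choice (fun a => quantize_pmf _ _ _ _ (Vp a) m0).
pose V' a b : R := #|[pred u | f a u == b]|%:R / m%:R.
have Pp : is_pmf (rv_law p Z) by exact: is_pmf_rv_law.
have Vp' a : is_pmf (V' a).
  split=> [b|]; first by rewrite divr_ge0.
  rewrite -mulr_suml -natr_sum.
  have -> : (\sum_b #|[pred u | f a u == b]|)%N = m.
    rewrite -[RHS]card_ord -[RHS]sum1_card (partition_big (f a) xpredT)//=.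
    by apply: eq_bigr => b _; rewrite -sum1_card.
  by rewrite mulfV// gt_eqF.
exists f; split=> [|c K cK].
  have -> : 1 + ln m%:R = 1 - ln (m%:R^-1) :> R by rewrite lnV ?posrE// opprK.
  apply: (mutual_info_kernel_le_dist _ _ _ _ _ _ _ _ _ _ _ (rv_law p Z) V V') => //.
  - by move=> a b; rewrite -WZ -WV /rv_law (big_pred1 (a, b))//; case.
  - by move=> a b; rewrite rv_law_with_uniform.
  - by rewrite invf_le1// ler1n.
have EE : expect (with_uniform p (m := m))
    (fun w => c (Z w.1) (f (Z w.1) w.2)) =
    \sum_a \sum_b rv_law p Z a * V' a b * c a b.
  rewrite -(expect_rv_law _ _ _ _ (fun w => (Z w.1, f (Z w.1) w.2))
             (fun z => c z.1 z.2)) /expect pair_big/=.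
  by apply: eq_bigr => -[a b] _; rewrite rv_law_with_uniform.
have EW : expect W (fun w => c w.1 w.2) =
    \sum_a \sum_b rv_law p Z a * V a b * c a b.
  by rewrite /expect pair_big/=; apply: eq_bigr => -[a b] _; rewrite -WZ -WV.
rewrite EE EW -[X in _ + X]mul1r -[X in _ + X * _]Pp.2 mulr_suml -big_split/=.
apply: ler_sum => a _.
have -> : rv_law p Z a * (K * (#|B|%:R / m%:R)) =
    \sum_(b : B) rv_law p Z a * (m%:R^-1 * K).
  by rewrite sumr_const -mulr_natl; ring.
rewrite -big_split/=; apply: ler_sum => b _.
rewrite -[_ * V' _ _ * _]mulrA -[_ * V _ _ * _]mulrA -mulrDr ler_wpM2l//; first exact: Pp.1.
(* Each output contributes at most |V' - V| c <= K / m; the sign of [c] is used in the first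
   bound. *)
have /andP[c0 cle] := cK a b.
rewrite -lerBlDl -mulrBl (le_trans (ler_wpM2r c0 (ler_norm _)))//.
by rewrite ler_pM//; exact: fV.
Qed.

(** * Bounds on expected costs, and the two inequalities of the theorem *)

Lemma le_limn_esup_EFin (R : realType) (u : nat -> R) (l : R) :
  (\forall n \near \oo, l <= u n) -> (l%:E <= limn_esup (fun n => (u n)%:E))%E.
Proof.
move=> lu; apply: le_ereal_inf_tmp => _ [V VF <-].
have [n [Vn ln]] : exists n, V n /\ l <= u n.
  by apply: (@filter_ex _ \oo); apply: filterI.
apply: (@le_trans _ _ (u n)%:E); first by rewrite lee_fin.
by apply: ereal_sup_ubound; exists n.
Qed.

Lemma expect_bounds (R : realType) (Omega : finType) (p : Omega -> R)
    (Z : Omega -> R) (l h : R) :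
  is_pmf p -> (forall w, l <= Z w <= h) -> l <= expect p Z <= h.
Proof.
move=> [p0 p1] lZh; have cst k : k = \sum_w p w * k.
  by rewrite -mulr_suml p1 mul1r.
rewrite (cst l) (cst h); apply/andP.
by split; apply: ler_sum => w _; rewrite ler_wpM2l//; case/andP: (lZh w).
Qed.

Lemma rv_law_with_uniform_fst (R : realType) (Omega A : finType)
    (p : Omega -> R) (m : nat) (Z : Omega -> A) (a : A) : (0 < m)%N ->
  rv_law (with_uniform p (m := m)) (fun w => Z w.1) a = rv_law p Z a.
Proof.
move=> m0; transitivity (\sum_(w | Z w == a) \sum_(u < m) p w / m%:R).
  by rewrite pair_big/=; apply: eq_bigl => w; rewrite andbT.
apply: eq_bigr => w _; rewrite sumr_const card_ord -[LHS]mulr_natr mulfVK//.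
by rewrite pnatr_eq0 -lt0n.
Qed.

Theorem corollary1 (R : realType) (X Xh : finType)
    (X_nonempty : (0 < #|X|)%N) (Xh_nonempty : (0 < #|Xh|)%N)
    (Omega : nat -> finType) (p : forall n, Omega n -> R)
    (p_pmf : forall n, (0 < n)%N -> is_pmf (p n))
    (Xn Yn : forall n, Omega n -> n.-tuple X)
    (c : forall n, n.-tuple X -> n.-tuple Xh -> R)
    (c_ge0 : forall n, (0 < n)%N -> forall x y, 0 <= c n x y)
    (c_bounded : exists B : R,
       forall n, (0 < n)%N -> forall x y, c n x y <= B)
    (eps r : R) (eps_ge0 : 0 <= eps)
    (Y_eq_X : forall n, (0 < n)%N -> forall w, Yn n w = Xn n w)
    (r_ge : ln (#|Xh|%:R : R) <= r) :
  min_avg_cost p Xn Yn c eps r =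
  ereal_inf [set sup_avg_cost c W | W in
    [set W : forall n, n.-tuple X * n.-tuple Xh -> R |
       joint_with p Xn W /\ (sup_info_rate W <= eps%:E)%E]].
Proof.
have near_gt0 : \forall n \near \oo, (0 < n)%N by exact: nbhs_infty_gt.
have Y_info n m (f : n.-tuple X -> 'I_m -> n.-tuple Xh) : (0 < n)%N ->
    mutual_info (with_uniform (p n) (m := m)) (fun w => Yn n w.1)
      (fun w => f (Xn n w.1) w.2) =
    mutual_info (with_uniform (p n) (m := m)) (fun w => Xn n w.1)
      (fun w => f (Xn n w.1) w.2).
  move=> n0; congr (mutual_info _ _ _).
  by apply/funext => w; exact: Y_eq_X.
apply/eqP; rewrite eq_le; apply/andP; split; last first.
  (* Lower bound on C_a: the joint law induced by an encoder is a competitor with the same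
     information and cost. *)
  apply: le_ereal_inf_tmp => _ [g [g0 [M [f [M0 _ info cost]]]] <-].
  pose W n := rv_law (with_uniform (p n) (m := M n))
    (fun w => (Xn n w.1, f n (Xn n w.1) w.2)).
  apply: le_trans cost; apply: ereal_inf_lbound; exists W; last first.
    by congr limn_esup; apply/funext => n; rewrite expect_rv_law.
  split=> [n n0|].
    split; first by apply/is_pmf_rv_law/is_pmf_with_uniform; auto.
    by move=> x; rewrite rv_law_rv_law/= rv_law_with_uniform_fst ?M0.
  apply/limn_esup_le_EFinP => e e0.
  move/limn_esup_le_EFinP: info => /(_ e e0) info.
  near=> n; rewrite mutual_info_rv_law -Y_info; last by near: n.
  by near: n.
(* Upper bound on C_a: the limiting cost of [W] is itself shown to be achievable. *)
apply: le_ereal_inf_tmp => _ [W [WX info] <-].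
have [K cK] := c_bounded.
(* Achievable costs are nonnegative reals, so the limit superior must first be shown finite; it lies
   between 0 and [K]. *)
have exp_itv n : (0 < n)%N -> 0 <= expect (W n) (fun w => c n w.1 w.2) <= K.
  move=> n0; apply: expect_bounds; first exact: (WX n n0).1.
  by move=> w; rewrite c_ge0// cK.
have s0 : (0%:E <= sup_avg_cost c W)%E.
  apply: le_limn_esup_EFin; near=> n.
  by have /exp_itv/andP[] : (0 < n)%N by near: n.
have sK : (sup_avg_cost c W <= K%:E)%E.
  apply/limn_esup_le_EFinP => e e0; near=> n.
  have /exp_itv/andP[_ cn] : (0 < n)%N by near: n.
  by rewrite (le_trans cn)// lerDl ltW.
have sfin : sup_avg_cost c W \is a fin_num.
  by rewrite ge0_fin_numE// (le_lt_trans sK) ?ltry.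
pose g := fine (sup_avg_cost c W).
have gE : sup_avg_cost c W = g%:E by rewrite /g fineK.
rewrite gE in s0 *; apply: ereal_inf_lbound; exists g => //; split; first by rewrite -lee_fin.
(* The factor [#|Xh| ^ n] cancels the number of output words in both error terms (see [NM]). The
   factor [n] makes the remainders vanish and adds only (ln n) / n to the rate. *)
pose M n := (#|Xh| ^ n * n)%N.
have M0 n : (0 < n)%N -> (0 < M n)%N by move=> n0; rewrite muln_gt0 expn_gt0 Xh_nonempty.
pose encoder n (f : n.-tuple X -> 'I_(M n) -> n.-tuple Xh) :=
  mutual_info (with_uniform (p n) (m := M n)) (fun w => Xn n w.1)
      (fun w => f (Xn n w.1) w.2) <=
    mutual_info (W n) fst snd +
    #|{: n.-tuple Xh}|%:R * ((M n)%:R^-1 * (1 + ln (M n)%:R)) *+ 2 /\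
  forall (c : n.-tuple X -> n.-tuple Xh -> R) (K : R),
    (forall a b, 0 <= c a b <= K) ->
    expect (with_uniform (p n) (m := M n)) (fun w => c (Xn n w.1) (f (Xn n w.1) w.2)) <=
      expect (W n) (fun w => c w.1 w.2) + K * (#|{: n.-tuple Xh}|%:R / (M n)%:R).
have fE n : exists f, (0 < n)%N -> encoder n f.
  (* The entry n = 0 is arbitrary; a constant encoder keeps the sequence total. *)
  have [n0|] := boolP (0 < n)%N; last first.
    have [y _] := fintype.card_gt0P Xh_nonempty.
    by exists (fun _ _ => nseq_tuple n y).
  have [f fP] := encoder_approximation _ _ _ _ (p n) (Xn n) (W n) (M n)
    (p_pmf n n0) (WX n n0).1 (WX n n0).2 (M0 n n0).
  by exists f.
have NM n : (0 < n)%N -> #|{: n.-tuple Xh}|%:R / (M n)%:R = n%:R^-1 :> R.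
  move=> n0; rewrite card_tuple /M natrM invfM mulrA mulfV ?mul1r//.
  by rewrite pnatr_eq0 -lt0n expn_gt0 Xh_nonempty.
set L := ln (#|Xh|%:R : R) in r_ge.
have lnM n : (0 < n)%N -> ln ((M n)%:R : R) = n%:R * L + ln n%:R.
  move=> n0; rewrite natrM lnM ?posrE ?ltr0n ?expn_gt0 ?Xh_nonempty//.
  by rewrite natrX lnXn ?ltr0n// mulr_natl.
exists M, (fun n => sval (cid (fE n))); split.
- exact: M0.
- apply/limn_esup_le_EFinP => e e0; near=> n.
  have n0 : (0 < n)%N by near: n.
  have n0' : 0 < n%:R :> R by rewrite ltr0n.
  (* The rate is L + (ln n) / n, with L <= r by [r_ge]. *)
  rewrite lnM// ler_pdivrMl// mulrDr [n%:R * e]mulrC lerD//.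
    by rewrite ler_wpM2l.
  by near: n; exact: near_ln_natr_le.
- apply/limn_esup_le_EFinP => e e0.
  have e20 : 0 < e / 2 by rewrite divr_gt0.
  move/limn_esup_le_EFinP: info => /(_ _ e20) info.
  near=> n.
  have n0 : (0 < n)%N by near: n.
  have n0' : 0 < n%:R :> R by rewrite ltr0n.
  have [fI _] := svalP (cid (fE n)) n0; rewrite Y_info//.
  apply: (le_trans (ler_wpM2l _ fI)); first by rewrite invr_ge0 ltW.
  rewrite [e]splitr [eps + _]addrA [leLHS]mulrDr lerD//; first by near: n.
  rewrite ler_pdivrMl// -[_ *+ 2]mulr_natr mulrA NM// lnM// -mulrA ler_pdivrMl//.
  have ln_n : ln (n%:R : R) <= n%:R by rewrite ltW// ln_sublinear.
  have n1 : 1 <= n%:R :> R by rewrite ler1n.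
  (* What remains is 2 (1 + n L + ln n) <= (e / 2) n^2. Since 1 and ln n are both at most n, the
     left side is at most 2 n (L + 2). *)
  have : n%:R * ((L + 2) * 2) <= n%:R * (e / 2 * n%:R).
    by rewrite ler_pM2l//; near: n; exact: near_mul_le_natr.
  lra.
- apply/limn_esup_le_EFinP => e e0.
  have e20 : 0 < e / 2 by rewrite divr_gt0.
  have cost : (sup_avg_cost c W <= g%:E)%E by rewrite gE.
  move/limn_esup_le_EFinP: cost => /(_ _ e20) cost.
  near=> n.
  have n0 : (0 < n)%N by near: n.
  have [_ fC] := svalP (cid (fE n)) n0.
  apply: (le_trans (fC _ K _)); first by move=> a b; rewrite c_ge0// cK.
  rewrite [e]splitr addrA lerD//; first by near: n.
  rewrite NM// ler_pdivrMr ?ltr0n//.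
  by near: n; exact: near_mul_le_natr.
Unshelve. all: by end_near. Qed.
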